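(* Let $X$ be a separable Banach space with $X^\ast$ non-separable. Then for every $\delta>0$ there exists a closed subspace $Y\subseteq X$ such that $(X/Y)^\ast$ is non-separable and the quotient space $X/Y$ has a Schauder basis with basis constant not exceeding $1+\delta$.
   Context: Banach spaces are real or complex; subspaces are norm-closed linear subspaces. *)

(* Defs.v *)
From Stdlib Require Import Reals Lra ClassicalEpsilon.
Open Scope R_scope.
Set Implicit Arguments.

Inductive field_kind := RealField | ComplexField.

Definition scal (k : field_kind) : Type :=
  match k with RealField => R | ComplexField => (R * R)%type end.

Definition sadd {k : field_kind} : scal k -> scal k -> scal k :=
  match k with
  | RealField => Rplus
  | ComplexField => fun x y => (fst x + fst y, snd x + snd y)
  end.

Definition sopp {k : field_kind} : scal k -> scal k :=
  match k with
  | RealField => Ropp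
  | ComplexField => fun x => (- fst x, - snd x)
  end.

Definition smul {k : field_kind} : scal k -> scal k -> scal k :=
  match k with
  | RealField => Rmult
  | ComplexField => fun x y =>
      (fst x * fst y - snd x * snd y, fst x * snd y + snd x * fst y)
  end.

Definition szero (k : field_kind) : scal k :=
  match k with RealField => 0 | ComplexField => (0, 0) end.

Definition sone (k : field_kind) : scal k :=
  match k with RealField => 1 | ComplexField => (1, 0) end.

Definition sabs {k : field_kind} : scal k -> R :=
  match k with
  | RealField => Rabs
  | ComplexField => fun x => sqrt (fst x * fst x + snd x * snd x)
  end.

Record BanachSpace (k : field_kind) := {
  carrier :> Type;
  vadd : carrier -> carrier -> carrier;
  vzero : carrier;
  vopp : carrier -> carrier;
  vscale : scal k -> carrier -> carrier;
  norm : carrier -> R;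
  vaddA : forall x y z, vadd x (vadd y z) = vadd (vadd x y) z;
  vaddC : forall x y, vadd x y = vadd y x;
  vadd0 : forall x, vadd x vzero = x;
  vaddN : forall x, vadd x (vopp x) = vzero;
  vscaleA : forall a b x, vscale a (vscale b x) = vscale (smul a b) x;
  vscale1 : forall x, vscale (sone k) x = x;
  vscaleDr : forall a x y, vscale a (vadd x y) = vadd (vscale a x) (vscale a y);
  vscaleDl : forall a b x, vscale (sadd a b) x = vadd (vscale a x) (vscale b x);
  norm_eq0 : forall x, norm x = 0 -> x = vzero;
  norm_scale : forall a x, norm (vscale a x) = sabs a * norm x;
  norm_triangle : forall x y, norm (vadd x y) <= norm x + norm y;
  complete : forall u : nat -> carrier,
    (forall eps, eps > 0 -> exists N, forall m n, (m >= N)%nat -> (n >= N)%nat ->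
        norm (vadd (u m) (vopp (u n))) < eps) ->
    exists x, forall eps, eps > 0 -> exists N, forall n, (n >= N)%nat ->
        norm (vadd (u n) (vopp x)) < eps
}.

Arguments vadd {k} _ _ _.
Arguments vzero {k} _.
Arguments vopp {k} _ _.
Arguments vscale {k} _ _ _.
Arguments norm {k} _ _.

Definition separable (k : field_kind) (X : BanachSpace k) : Prop :=
  exists d : nat -> X, forall (x : X) eps, eps > 0 ->
    exists n, norm X (vadd X x (vopp X (d n))) < eps.

Definition closed_subspace (k : field_kind) (X : BanachSpace k) (Y : X -> Prop) : Prop :=
  Y (vzero X) /\
  (forall x y, Y x -> Y y -> Y (vadd X x y)) /\
  (forall a x, Y x -> Y (vscale X a x)) /\
  (forall (u : nat -> X) (x : X), (forall n, Y (u n)) ->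
     (forall eps, eps > 0 -> exists N, forall n, (n >= N)%nat ->
        norm X (vadd X (u n) (vopp X x)) < eps) -> Y x).

(** * Seminormed presentations of normed spaces.
    A normed space is presented as a vector space V with a seminorm p; the
    space itself is V modulo the kernel of p.  This is used to present the
    quotient X/Y with carrier X and the quotient norm x |-> dist(x, Y). *)
Record SNSpace (k : field_kind) := {
  sn_carrier :> Type;
  sn_add : sn_carrier -> sn_carrier -> sn_carrier;
  sn_zero : sn_carrier;
  sn_opp : sn_carrier -> sn_carrier;
  sn_scale : scal k -> sn_carrier -> sn_carrier;
  sn_norm : sn_carrier -> R
}.

Arguments sn_add {k} _ _ _.
Arguments sn_zero {k} _.
Arguments sn_opp {k} _ _.
Arguments sn_scale {k} _ _ _.
Arguments sn_norm {k} _ _.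

Definition to_sn (k : field_kind) (X : BanachSpace k) : SNSpace k :=
  {| sn_carrier := X; sn_add := vadd X; sn_zero := vzero X; sn_opp := vopp X;
     sn_scale := vscale X; sn_norm := norm X |}.

Definition is_inf (E : R -> Prop) (m : R) : Prop :=
  (forall z, E z -> m <= z) /\ (forall b, (forall z, E z -> b <= z) -> b <= m).

Definition qnorm (k : field_kind) (X : BanachSpace k) (Y : X -> Prop) (x : X) : R :=
  epsilon (inhabits 0)
    (is_inf (fun d => exists y, Y y /\ d = norm X (vadd X x (vopp X y)))).

Definition quotient (k : field_kind) (X : BanachSpace k) (Y : X -> Prop) : SNSpace k :=
  {| sn_carrier := X; sn_add := vadd X; sn_zero := vzero X; sn_opp := vopp X;
     sn_scale := vscale X; sn_norm := @qnorm k X Y |}.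

Definition bounded_linear_functional (k : field_kind) (S : SNSpace k) (f : S -> scal k) : Prop :=
  (forall x y, f (sn_add S x y) = sadd (f x) (f y)) /\
  (forall a x, f (sn_scale S a x) = smul a (f x)) /\
  (exists C, forall x, sabs (f x) <= C * sn_norm S x).

(** S^* is separable: it has a countable subset dense for the operator norm
    (||f - g|| <= eps  iff  |f x - g x| <= eps ||x|| for all x). *)
Definition dual_separable (k : field_kind) (S : SNSpace k) : Prop :=
  exists g : nat -> (S -> scal k),
    (forall n, bounded_linear_functional S (g n)) /\
    forall f, bounded_linear_functional S f -> forall eps, eps > 0 ->
      exists n, forall x, sabs (sadd (f x) (sopp (g n x))) <= eps * sn_norm S x.

Fixpoint sn_sum (k : field_kind) (Sp : SNSpace k) (u : nat -> Sp) (n : nat) : Sp :=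
  match n with
  | O => sn_zero Sp
  | S n' => sn_add Sp (sn_sum Sp u n') (u n')
  end.

Definition partial_sum (k : field_kind) (S : SNSpace k) (e : nat -> S) (a : nat -> scal k)
  (n : nat) : S := sn_sum S (fun i => sn_scale S (a i) (e i)) n.

Definition sn_converges (k : field_kind) (S : SNSpace k) (u : nat -> S) (x : S) : Prop :=
  forall eps, eps > 0 -> exists N, forall n, (n >= N)%nat ->
    sn_norm S (sn_add S (u n) (sn_opp S x)) < eps.

Definition expansion (k : field_kind) (S : SNSpace k) (e : nat -> S) (a : nat -> scal k)
  (x : S) : Prop := sn_converges S (partial_sum S e a) x.

Definition schauder_basis (k : field_kind) (S : SNSpace k) (e : nat -> S) : Prop :=
  forall x : S, exists! a : nat -> scal k, expansion S e a x.

Definition basis_constant_le (k : field_kind) (S : SNSpace k) (e : nat -> S) (c : R) : Prop :=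
  forall (x : S) (a : nat -> scal k), expansion S e a x ->
    forall n, sn_norm S (partial_sum S e a n) <= c * sn_norm S x.

(* Main.v *)
(** Call a set of functionals [eps]-covered if countably many functionals form an [eps]-net of it.
    Some ball of [X*] is not covered for some [eps]; discarding its points with a covered weak-star
    neighbourhood leaves a nonempty bounded set [A] in which every [g] is a weak-star limit of
    points at distance more than [eps] from [g].

    Starting from [G 0] in [A], choose successively [G (n+1)] in [A], far in norm from an earlier
    [G (p n)] but weak-star close to it, and let [f n] be a tiny perturbation of
    [G (n+1) - G (p n)] vanishing exactly on the finite sets [F j], [j < n].  These sets exhaust a
    dense sequence, and [F 0], ..., [F n] span almost optimal solutions of all the moment problems
    [f i z = f i y], [i <= n].  So [f i z = 0] for the later [i], which makes the partial sum
    projections of the dual system on the quotient by the common kernel [Y] of the [f n] bounded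
    by [1 + delta].

    Sums of [f n] along a path in the tree given by [p] telescope up to the perturbations, so they
    are bounded and converge pointwise to functionals vanishing on [Y].  At each stage one may
    or may not add [f n], and this changes the value at a vector [x n] of controlled norm by [1],
    a value untouched afterwards; a diagonal argument then avoids any given sequence of
    functionals on [X/Y]. *)
Require Import Defs.
From Stdlib Require Import Reals Lra Lia List Ring Cantor.
From Stdlib Require Import Classical ClassicalEpsilon FunctionalExtensionality.
Open Scope R_scope.

(** * Scalars *)

Definition ssub {k : field_kind} (a b : scal k) : scal k := sadd a (sopp b).

Lemma scal_ring (k : field_kind) :
  ring_theory (szero k) (sone k) sadd smul ssub sopp eq.
Proof.
split; unfold ssub; destruct k; cbn; intros;
  repeat match goal with x : (R * R)%type |- _ => destruct x end; cbn;
  try (f_equal; ring); ring.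
Qed.

Definition re {k : field_kind} : scal k -> R :=
  match k with RealField => fun x => x | ComplexField => fst end.

Definition im {k : field_kind} : scal k -> R :=
  match k with RealField => fun _ => 0 | ComplexField => snd end.

Definition mk {k : field_kind} : R -> R -> scal k :=
  match k with RealField => fun a _ => a | ComplexField => pair end.

Lemma sabs_pos {k : field_kind} (a : scal k) : 0 <= sabs a.
Proof. destruct k; cbn; [apply Rabs_pos | apply sqrt_pos]. Qed.

Lemma sabs0 (k : field_kind) : sabs (szero k) = 0.
Proof.
destruct k; cbn; [apply Rabs_R0 |].
replace (0 * 0 + 0 * 0) with 0 by ring; apply sqrt_0.
Qed.

Lemma sabs1 (k : field_kind) : sabs (sone k) = 1.
Proof.
destruct k; cbn; [apply Rabs_R1 |].
replace (1 * 1 + 0 * 0) with 1 by ring; apply sqrt_1.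
Qed.

Lemma sabs_opp {k : field_kind} (a : scal k) : sabs (sopp a) = sabs a.
Proof. destruct k; cbn; [apply Rabs_Ropp | f_equal; ring]. Qed.

Lemma sabs_mul {k : field_kind} (a b : scal k) : sabs (smul a b) = sabs a * sabs b.
Proof.
destruct k; cbn; [apply Rabs_mult |].
rewrite <- sqrt_mult by nra; f_equal; ring.
Qed.

Lemma sabs_add {k : field_kind} (a b : scal k) : sabs (sadd a b) <= sabs a + sabs b.
Proof.
destruct k; cbn; [apply Rabs_triang |].
destruct a as [a1 a2], b as [b1 b2]; cbn.
set (A := sqrt (a1 * a1 + a2 * a2)); set (B := sqrt (b1 * b1 + b2 * b2)).
assert (HA : 0 <= A) by apply sqrt_pos.
assert (HB : 0 <= B) by apply sqrt_pos.
assert (EA : A * A = a1 * a1 + a2 * a2) by (apply sqrt_sqrt; nra).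
assert (EB : B * B = b1 * b1 + b2 * b2) by (apply sqrt_sqrt; nra).
rewrite <- (sqrt_square (A + B)) by lra.
apply sqrt_le_1_alt.
(* Cauchy-Schwarz in the plane: the squares of the two sides differ by the square of
   [a1 * b2 - a2 * b1]. *)
assert (H : a1 * b1 + a2 * b2 <= A * B).
{ apply Rsqr_incr_0_var; [unfold Rsqr | nra].
  replace (A * B * (A * B)) with ((A * A) * (B * B)) by ring.
  rewrite EA, EB; assert (Q := Rle_0_sqr (a1 * b2 - a2 * b1)); unfold Rsqr in Q; lra. }
nra.
Qed.

Lemma sabs_eq0 {k : field_kind} (a : scal k) : sabs a = 0 -> a = szero k.
Proof.
destruct k; cbn; intro H.
- destruct (Req_dec a 0) as [E | E]; [exact E | destruct (Rabs_no_R0 _ E H)].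
- destruct a as [x y]; cbn in *.
  apply sqrt_eq_0 in H; [| nra].
  assert (x = 0) by nra; assert (y = 0) by nra; subst; reflexivity.
Qed.

Lemma sabs_le_re_im {k : field_kind} (a : scal k) : sabs a <= Rabs (re a) + Rabs (im a).
Proof.
destruct k; cbn; [rewrite Rabs_R0; lra |].
destruct a as [x y]; cbn.
assert (Hx := Rabs_pos x); assert (Hy := Rabs_pos y).
rewrite <- (sqrt_square (Rabs x + Rabs y)) by lra.
apply sqrt_le_1_alt.
assert (Ex : Rabs x * Rabs x = x * x) by (rewrite <- Rabs_mult; apply Rabs_pos_eq; nra).
assert (Ey : Rabs y * Rabs y = y * y) by (rewrite <- Rabs_mult; apply Rabs_pos_eq; nra).
nra.
Qed.

Lemma re_le_sabs {k : field_kind} (a : scal k) : Rabs (re a) <= sabs a.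
Proof.
destruct k; cbn; [lra |].
destruct a as [x y]; cbn; rewrite <- sqrt_Rsqr_abs.
apply sqrt_le_1_alt; unfold Rsqr; nra.
Qed.

Lemma im_le_sabs {k : field_kind} (a : scal k) : Rabs (im a) <= sabs a.
Proof.
destruct k; cbn; [rewrite Rabs_R0; apply Rabs_pos |].
destruct a as [x y]; cbn; rewrite <- sqrt_Rsqr_abs.
apply sqrt_le_1_alt; unfold Rsqr; nra.
Qed.

Lemma re_sub {k : field_kind} (a b : scal k) : re (ssub a b) = re a - re b.
Proof. destruct k; reflexivity. Qed.

Lemma im_sub {k : field_kind} (a b : scal k) : im (ssub a b) = im a - im b.
Proof. destruct k; cbn; [ring | reflexivity]. Qed.

Lemma re_mk {k : field_kind} (a b : R) : re (k := k) (mk a b) = a.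
Proof. destruct k; reflexivity. Qed.

Lemma sinv_ex {k : field_kind} (a : scal k) :
  a <> szero k -> exists b, smul b a = sone k.
Proof.
destruct k; cbn; intro H.
- exists (/ a); field; exact H.
- destruct a as [x y].
  assert (E : x * x + y * y <> 0).
  { intro E; apply H; assert (x = 0) by nra; assert (y = 0) by nra; subst; reflexivity. }
  exists (x / (x * x + y * y), - y / (x * x + y * y)); cbn; f_equal; field; exact E.
Qed.

Lemma sreal_ex (k : field_kind) (r : R) : 0 <= r -> exists a : scal k, sabs a = r.
Proof.
intro Hr; destruct k; cbn.
- exists r; apply Rabs_pos_eq, Hr.
- exists (r, 0); cbn; replace (r * r + 0 * 0) with (r * r) by ring; apply sqrt_square, Hr.
Qed.

Lemma scal_complete {k : field_kind} (u : nat -> scal k) :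
  (forall eps, eps > 0 -> exists N, forall m n, (m >= N)%nat -> (n >= N)%nat ->
     sabs (ssub (u m) (u n)) < eps) ->
  exists l, forall eps, eps > 0 -> exists N, forall n, (n >= N)%nat ->
     sabs (ssub (u n) l) < eps.
Proof.
intro Hu.
destruct (R_complete (fun n => re (u n))) as [a Ha].
{ intros eps He; destruct (Hu eps He) as [N HN]; exists N; intros n m Hn Hm.
  unfold Rdist; rewrite <- re_sub.
  eapply Rle_lt_trans; [apply re_le_sabs | apply HN; lia]. }
destruct (R_complete (fun n => im (u n))) as [b Hb].
{ intros eps He; destruct (Hu eps He) as [N HN]; exists N; intros n m Hn Hm.
  unfold Rdist; rewrite <- im_sub.
  eapply Rle_lt_trans; [apply im_le_sabs | apply HN; lia]. }
exists (mk a b); intros eps He.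
destruct (Ha (eps / 2) ltac:(lra)) as [N1 H1], (Hb (eps / 2) ltac:(lra)) as [N2 H2].
exists (N1 + N2)%nat; intros n Hn.
specialize (H1 n ltac:(lia)); specialize (H2 n ltac:(lia)); unfold Rdist in *.
eapply Rle_lt_trans; [apply sabs_le_re_im |].
rewrite re_sub, im_sub, re_mk.
destruct k; cbn in *; [rewrite Rminus_0_r, Rabs_R0 |]; lra.
Qed.

(** * Total boundedness *)

(** Finitely many bounded functions map [P] onto a totally bounded set. Cutting [P] by the values of
    the first function leaves fewer functions to control on each slice, so the induction runs over
    all [P] at once. *)
Lemma list_net {T : Type} (fs : list (T -> R)) (eta : R) : eta > 0 ->
  forall P : T -> Prop,
  (forall f, In f fs -> exists M, forall t, P t -> Rabs (f t) <= M) ->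
  exists l : list T, (forall s, In s l -> P s) /\
    forall t, P t -> exists s, In s l /\ forall f, In f fs -> Rabs (f t - f s) < eta.
Proof.
intro Heta; induction fs as [| f fs IH]; intros P HP.
- destruct (classic (exists t, P t)) as [[t Ht] | H].
  + exists (t :: nil); split; [intros s [<- | []]; exact Ht |].
    intros t' _; exists t; split; [left; reflexivity | intros f []].
  + exists nil; split; [intros s [] | intros t Ht; destruct H; eauto].
- destruct (HP f (or_introl eq_refl)) as [M HM].
  assert (HP' : forall g, In g fs -> exists M, forall t, P t -> Rabs (g t) <= M)
    by (intros g Hg; apply HP; right; exact Hg).
  (* Cut the range of [f] into intervals shorter than [eta]. *)
  assert (HK : forall K : nat, exists l : list T, (forall s, In s l -> P s) /\
    forall t, P t -> f t <= - M + INR K * (eta / 2) -> exists s, In s l /\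
      forall g, In g (f :: fs) -> Rabs (g t - g s) < eta).
  { induction K as [| K [l [Hl1 Hl2]]].
    - destruct (IH (fun t => P t /\ f t = - M)) as [l [H1 H2]].
      { intros g Hg; destruct (HP' g Hg) as [M' HM']; exists M'; intros t [Ht _]; auto. }
      exists l; split; [intros s Hs; apply H1, Hs |].
      intros t Ht Hf; cbn in Hf.
      assert (E : f t = - M).
      { specialize (HM t Ht); unfold Rabs in HM; destruct (Rcase_abs (f t)); lra. }
      destruct (H2 t (conj Ht E)) as [s [Hs1 Hs2]]; exists s; split; [exact Hs1 |].
      intros g [<- | Hg]; [| apply Hs2, Hg].
      destruct (H1 s Hs1) as [_ Es]; rewrite E, Es, Rminus_diag, Rabs_R0; exact Heta.
    - set (c := - M + INR K * (eta / 2)) in *.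
      destruct (IH (fun t => P t /\ c <= f t <= c + eta / 2)) as [l' [H1 H2]].
      { intros g Hg; destruct (HP' g Hg) as [M' HM']; exists M'; intros t [Ht _]; auto. }
      exists (l ++ l'); split.
      { intros s Hs; apply in_app_or in Hs as [Hs | Hs]; [apply Hl1, Hs | apply H1, Hs]. }
      intros t Ht Hf; destruct (Rle_dec (f t) c) as [Hc | Hc].
      + destruct (Hl2 t Ht Hc) as [s [Hs1 Hs2]]; exists s; split; [| exact Hs2].
        apply in_or_app; left; exact Hs1.
      + rewrite S_INR in Hf.
        destruct (H2 t) as [s [Hs1 Hs2]]; [split; [exact Ht | unfold c in *; lra] |].
        exists s; split; [apply in_or_app; right; exact Hs1 |].
        intros g [<- | Hg]; [| apply Hs2, Hg].
        destruct (H1 s Hs1) as [_ Es]; apply Rabs_def1; unfold c in *; lra. }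
  (* So many steps of length [eta / 2] lead from [- M] past [M], and the slices exhaust [P]. *)
  destruct (INR_unbounded (2 * M / (eta / 2))) as [K HKM].
  destruct (HK K) as [l [H1 H2]]; exists l; split; [exact H1 |].
  intros t Ht; apply H2; [exact Ht |].
  assert (2 * M < INR K * (eta / 2)).
  { apply Rmult_lt_compat_r with (r := eta / 2) in HKM; [| lra].
    unfold Rdiv in HKM at 1; rewrite Rmult_assoc, Rinv_l in HKM by lra; lra. }
  specialize (HM t Ht); unfold Rabs in HM; destruct (Rcase_abs (f t)); lra.
Qed.

(** It serves in two roles: with functionals as points and evaluations as [phi], and with vectors of
    the unit ball as points and functionals as [phi]. *)
Lemma scalar_net {k : field_kind} {T : Type} (P : T -> Prop) (phi : nat -> T -> scal k)
    (n : nat) (eta : R) : eta > 0 ->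
  (forall i, (i < n)%nat -> exists M, forall t, P t -> sabs (phi i t) <= M) ->
  exists l : list T, (forall s, In s l -> P s) /\
    forall t, P t -> exists s, In s l /\
      forall i, (i < n)%nat -> sabs (ssub (phi i t) (phi i s)) < eta.
Proof.
intros Heta Hb.
destruct (list_net (map (fun i t => re (phi i t)) (seq 0 n) ++
                    map (fun i t => im (phi i t)) (seq 0 n)) (eta / 2) ltac:(lra) P)
  as [l [H1 H2]].
{ intros f Hf; apply in_app_or in Hf as [Hf | Hf]; apply in_map_iff in Hf as [i [<- Hi]];
    apply in_seq in Hi; destruct (Hb i ltac:(lia)) as [M HM]; exists M; intros t Ht;
    (eapply Rle_trans; [| apply HM, Ht]); [apply re_le_sabs | apply im_le_sabs]. }
exists l; split; [exact H1 |].
intros t Ht; destruct (H2 t Ht) as [s [Hs1 Hs2]]; exists s; split; [exact Hs1 |].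
intros i Hi; eapply Rle_lt_trans; [apply sabs_le_re_im |].
rewrite re_sub, im_sub.
assert (A := Hs2 (fun t => re (phi i t))); assert (B := Hs2 (fun t => im (phi i t))); cbn in A, B.
assert (In i (seq 0 n)) by (apply in_seq; lia).
enough (Rabs (re (phi i t) - re (phi i s)) < eta / 2 /\
        Rabs (im (phi i t) - im (phi i s)) < eta / 2) by lra.
split; [apply A | apply B]; apply in_or_app; [left | right];
  (apply in_map_iff; exists i; split; [reflexivity | assumption]).
Qed.

(** * Functionals *)

Section Functionals.
Context {k : field_kind} {X : BanachSpace k}.
Add Ring scal_ring_k : (scal_ring k).

Implicit Types x y z : X.
Implicit Types f g h : X -> scal k.

Definition vsub x y : X := vadd X x (vopp X y).

Definition lin f : Prop :=
  (forall x y, f (vadd X x y) = sadd (f x) (f y)) /\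
  (forall a x, f (vscale X a x) = smul a (f x)).

Definition bdd f (C : R) : Prop := forall x, sabs (f x) <= C * norm X x.

Definition dual f : Prop := lin f /\ exists C, bdd f C.

Fixpoint vsum (u : nat -> X) (n : nat) : X :=
  match n with O => vzero X | S n' => vadd X (vsum u n') (u n') end.

Fixpoint ssum (u : nat -> scal k) (n : nat) : scal k :=
  match n with O => szero k | S n' => sadd (ssum u n') (u n') end.

Lemma vadd_cancel x y z : vadd X x z = vadd X y z -> x = y.
Proof.
intro H; apply (f_equal (fun w => vadd X w (vopp X z))) in H.
rewrite <- !vaddA, vaddN, !vadd0 in H; exact H.
Qed.

Lemma vscale0 x : vscale X (szero k) x = vzero X.
Proof.
apply (vadd_cancel _ _ (vscale X (szero k) x)).
rewrite <- vscaleDl, (vaddC _ (vzero X)), vadd0; f_equal; ring.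
Qed.

Lemma vscale_v0 a : vscale X a (vzero X) = vzero X.
Proof.
apply (vadd_cancel _ _ (vscale X a (vzero X))).
rewrite <- vscaleDr, vadd0, vaddC, vadd0; reflexivity.
Qed.

Lemma vopp_scale x : vopp X x = vscale X (sopp (sone k)) x.
Proof.
apply (vadd_cancel _ _ x).
rewrite (vaddC _ (vopp X x)), vaddN.
rewrite <- (vscale1 X x) at 2; rewrite <- vscaleDl.
replace (sadd (sopp (sone k)) (sone k)) with (szero k) by ring.
symmetry; apply vscale0.
Qed.

Lemma vopp_add x y : vopp X (vadd X x y) = vadd X (vopp X x) (vopp X y).
Proof. rewrite !vopp_scale; apply vscaleDr. Qed.

Lemma vopp_opp x : vopp X (vopp X x) = x.
Proof.
rewrite !vopp_scale, vscaleA; rewrite <- (vscale1 X x) at 2; f_equal; ring.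
Qed.

Lemma vsub0 x : vsub x (vzero X) = x.
Proof. unfold vsub; rewrite vopp_scale, vscale_v0; apply vadd0. Qed.

Lemma norm0 : norm X (vzero X) = 0.
Proof. rewrite <- (vscale0 (vzero X)), norm_scale, sabs0; ring. Qed.

Lemma norm_opp x : norm X (vopp X x) = norm X x.
Proof. rewrite vopp_scale, norm_scale, sabs_opp, sabs1; ring. Qed.

Lemma norm_ge0 x : 0 <= norm X x.
Proof.
assert (H := norm_triangle X x (vopp X x)).
rewrite vaddN, norm_opp, norm0 in H; lra.
Qed.

Lemma lin0 f : lin f -> f (vzero X) = szero k.
Proof. intros [_ H]; rewrite <- (vscale0 (vzero X)), H; ring. Qed.

Lemma lin_sub f x y : lin f -> f (vsub x y) = ssub (f x) (f y).
Proof. intros [H1 H2]; unfold vsub; rewrite H1, vopp_scale, H2; ring. Qed.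

Lemma lin_vsum f u n : lin f -> f (vsum u n) = ssum (fun i => f (u i)) n.
Proof.
intro H; induction n as [| n IH]; cbn; [apply lin0, H |].
rewrite (proj1 H), IH; reflexivity.
Qed.

Lemma ssum_ext (u v : nat -> scal k) n :
  (forall i, (i < n)%nat -> u i = v i) -> ssum u n = ssum v n.
Proof.
induction n as [| n IH]; intro H; cbn; [reflexivity |].
rewrite IH, (H n) by (intros; auto with arith); reflexivity.
Qed.

Lemma ssum_0 (u : nat -> scal k) n :
  (forall i, (i < n)%nat -> u i = szero k) -> ssum u n = szero k.
Proof.
induction n as [| n IH]; intro H; cbn; [reflexivity |].
rewrite IH, (H n) by (intros; auto with arith); ring.
Qed.

Lemma ssum_delta (u : nat -> scal k) n i : (i < n)%nat ->
  (forall j, (j < n)%nat -> j <> i -> u j = szero k) -> ssum u n = u i.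
Proof.
induction n as [| n IH]; intros Hi H; [lia |]; cbn.
destruct (Nat.eq_dec i n) as [-> | E].
- rewrite ssum_0 by (intros; apply H; lia); ring.
- rewrite IH, (H n) by (try (intros; apply H); lia); ring.
Qed.

Lemma lin_plus f g : lin f -> lin g -> lin (fun x => sadd (f x) (g x)).
Proof.
intros [F1 F2] [G1 G2]; split; intros; rewrite ?F1, ?G1, ?F2, ?G2; ring.
Qed.

Lemma lin_minus f g : lin f -> lin g -> lin (fun x => ssub (f x) (g x)).
Proof.
intros [F1 F2] [G1 G2]; split; intros; rewrite ?F1, ?G1, ?F2, ?G2; ring.
Qed.

Lemma lin_zero : lin (fun _ => szero k).
Proof. split; intros; ring. Qed.

Lemma ssub_triangle (a b c : scal k) :
  sabs (ssub a c) <= sabs (ssub a b) + sabs (ssub b c).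
Proof.
replace (ssub a c) with (sadd (ssub a b) (ssub b c)) by ring; apply sabs_add.
Qed.

Lemma ssub_sym (a b : scal k) : sabs (ssub a b) = sabs (ssub b a).
Proof. rewrite <- sabs_opp; f_equal; ring. Qed.

Lemma sabs_le_ssub (a b : scal k) : sabs a <= sabs (ssub a b) + sabs b.
Proof. replace a with (sadd (ssub a b) b) at 1 by ring; apply sabs_add. Qed.

Lemma ssub_diag (a : scal k) : ssub a a = szero k.
Proof. ring. Qed.

Lemma ssub_eq0 (a b : scal k) : ssub a b = szero k -> a = b.
Proof.
intro H; replace a with (sadd (ssub a b) b) by ring; rewrite H; ring.
Qed.

Lemma bdd_plus f g C D : bdd f C -> bdd g D -> bdd (fun x => sadd (f x) (g x)) (C + D).
Proof.
intros F G x; eapply Rle_trans; [apply sabs_add |].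
specialize (F x); specialize (G x); lra.
Qed.

Lemma bdd_minus f g C D : bdd f C -> bdd g D -> bdd (fun x => ssub (f x) (g x)) (C + D).
Proof.
intros F G x; unfold ssub; eapply Rle_trans; [apply sabs_add |]; rewrite sabs_opp.
specialize (F x); specialize (G x); lra.
Qed.

Lemma dual_plus f g : dual f -> dual g -> dual (fun x => sadd (f x) (g x)).
Proof.
intros [F [C HC]] [G [D HD]]; split; [apply lin_plus; assumption |].
exists (C + D); apply bdd_plus; assumption.
Qed.

Lemma dual_minus f g : dual f -> dual g -> dual (fun x => ssub (f x) (g x)).
Proof.
intros [F [C HC]] [G [D HD]]; split; [apply lin_minus; assumption |].
exists (C + D); apply bdd_minus; assumption.
Qed.

Lemma dual_scale a f : dual f -> dual (fun x => smul a (f x)).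
Proof.
intros [[F1 F2] [C HC]]; split.
- split; intros; rewrite ?F1, ?F2; ring.
- exists (sabs a * C); intro x; rewrite sabs_mul, Rmult_assoc.
  apply Rmult_le_compat_l; [apply sabs_pos | apply HC].
Qed.

Lemma dual_zero : dual (fun _ => szero k).
Proof. split; [apply lin_zero | exists 0; intro x; rewrite sabs0; lra]. Qed.

Lemma bdd_weaken f C D : C <= D -> bdd f C -> bdd f D.
Proof. intros H F x; specialize (F x); assert (N := norm_ge0 x); nra. Qed.

Lemma dual_bound f : dual f -> exists C, 0 < C /\ bdd f C.
Proof.
intros [_ [C HC]]; exists (Rmax C 1); split; [assert (H := Rmax_r C 1); lra |].
eapply bdd_weaken; [apply Rmax_l | exact HC].
Qed.

(** * Prescribing small values on a finite set *)

(** Subtracting [h] makes [f] vanish exactly on [L], at a cost in norm proportional to [eta] with a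
    factor depending on [L] alone. *)
Lemma small_extension (L : list X) : exists C, 0 <= C /\
  forall f eta, dual f -> (forall v, In v L -> sabs (f v) <= eta) -> 0 <= eta ->
  exists h, dual h /\ bdd h (C * eta) /\ forall v, In v L -> h v = f v.
Proof.
induction L as [| v L [C [HC IH]]].
- exists 0; split; [lra |]; intros f eta _ _ He; exists (fun _ => szero k).
  split; [apply dual_zero |]; split; [intro x; rewrite sabs0; lra | intros v []].
(* Either some functional killing the tail [L] is nonzero at [v] and can correct the value there, or
   the values on [L] already determine the value at [v]. *)
- destruct (classic (exists w, dual w /\ (forall u, In u L -> w u = szero k) /\ w v <> szero k))
    as [[w0 [Hw0 [Hz Hv]]] | Hno].
  + destruct (sinv_ex _ Hv) as [b Hb].
    pose (w := fun x => smul b (w0 x)).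
    assert (Hw : dual w) by (apply dual_scale; exact Hw0).
    destruct (dual_bound _ Hw) as [D [HD Bw]].
    assert (Nv := norm_ge0 v).
    exists (C + (1 + C * norm X v) * D); split; [assert (0 <= C * norm X v) by nra; nra |].
    intros f eta Hf Hs He.
    destruct (IH f eta Hf (fun u Hu => Hs u (or_intror Hu)) He) as [h [Hh [Bh Eh]]].
    pose (c := ssub (f v) (h v)).
    assert (Hc : sabs c <= (1 + C * norm X v) * eta).
    { unfold c, ssub; eapply Rle_trans; [apply sabs_add |]; rewrite sabs_opp.
      specialize (Bh v); specialize (Hs v (or_introl eq_refl)); lra. }
    exists (fun x => sadd (h x) (smul c (w x))); split; [| split].
    * apply dual_plus; [exact Hh | apply dual_scale, Hw].
    * intro x; eapply Rle_trans; [apply sabs_add |]; rewrite sabs_mul.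
      assert (A := Bh x); assert (B := Bw x); assert (S := sabs_pos c).
      assert (sabs c * sabs (w x) <= ((1 + C * norm X v) * eta) * (D * norm X x)).
      { apply Rmult_le_compat; auto using sabs_pos. }
      lra.
    * intros u [<- | Hu].
      -- unfold w; rewrite Hb; unfold c; ring.
      -- unfold w; rewrite (Hz u Hu), (Eh u Hu); ring.
  + exists C; split; [exact HC |].
    intros f eta Hf Hs He.
    destruct (IH f eta Hf (fun u Hu => Hs u (or_intror Hu)) He) as [h [Hh [Bh Eh]]].
    exists h; split; [exact Hh |]; split; [exact Bh |].
    intros u [<- | Hu]; [| apply Eh, Hu].
    apply NNPP; intro E; apply Hno; exists (fun x => ssub (h x) (f x)).
    split; [apply dual_minus; assumption |]; split.
    * intros u Hu; rewrite (Eh u Hu); ring.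
    * intro E'; apply E, ssub_eq0, E'.
Qed.

(** * Non-separability of the dual *)

Definition close f g (eps : R) : Prop := bdd (fun x => ssub (f x) (g x)) eps.

Definition covered (eps : R) (B : (X -> scal k) -> Prop) : Prop :=
  exists g : nat -> X -> scal k, (forall n, dual (g n)) /\
    forall f, B f -> exists n, close f (g n) eps.

Lemma covered_sub eps (A B : (X -> scal k) -> Prop) :
  (forall f, A f -> B f) -> covered eps B -> covered eps A.
Proof. intros H [g [H1 H2]]; exists g; split; auto. Qed.

Lemma covered_union eps (B : nat -> (X -> scal k) -> Prop) :
  (forall n, covered eps (B n)) -> covered eps (fun f => exists n, B n f).
Proof.
intro H.
destruct (choice _ H) as [g Hg].
exists (fun m => g (fst (of_nat m)) (snd (of_nat m))); split.
- intro m; apply Hg.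
- intros f [n Hn]; destruct (proj2 (Hg n) f Hn) as [m Hm].
  exists (to_nat (n, m)); rewrite cancel_of_to; exact Hm.
Qed.

Lemma covered_list {T : Type} eps (l : list T) (B : T -> (X -> scal k) -> Prop) :
  (forall t, In t l -> covered eps (B t)) -> covered eps (fun f => exists t, In t l /\ B t f).
Proof.
intro H.
apply covered_sub with (B := fun f => exists n, exists t, nth_error l n = Some t /\ B t f).
- intros f [t [Ht Bt]]; destruct (In_nth_error _ _ Ht) as [n Hn]; eauto.
- apply covered_union; intro n; destruct (nth_error l n) as [t |] eqn:E.
  + apply covered_sub with (B := B t); [| apply H; eapply nth_error_In, E].
    intros f [t' [[= <-] Ht']]; exact Ht'.
  + exists (fun _ _ => szero k); split; [intros _; apply dual_zero |].
    intros f [t' [[=] _]].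
Qed.

(** Otherwise the nets of the balls of radius [INR n + 1] at the scales [/ (INR m + 1)] unite to a
    countable dense subset of the dual. *)
Lemma ball_not_covered : ~ dual_separable (to_sn X) ->
  exists M eps, 0 < M /\ 0 < eps /\ ~ covered eps (fun f => lin f /\ bdd f M).
Proof.
intro Hns; apply NNPP; intro Hno; apply Hns.
assert (H : forall m, covered (/ (INR m + 1)) (fun f => exists n, lin f /\ bdd f (INR n + 1))).
{ intro m; apply (covered_union _ (fun n f => lin f /\ bdd f (INR n + 1))).
  intro n; apply NNPP; intro Hc; apply Hno.
  assert (A := pos_INR n); assert (B := pos_INR m).
  exists (INR n + 1), (/ (INR m + 1)); repeat split;
    [lra | apply Rinv_0_lt_compat; lra | exact Hc]. }
destruct (choice _ H) as [g Hg].
exists (fun m => g (fst (of_nat m)) (snd (of_nat m))); split.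
- intro m; destruct (proj1 (Hg (fst (of_nat m))) (snd (of_nat m))) as [[A B] C].
  split; [exact A | split; [exact B | exact C]].
- intros f [F1 [F2 [C HC]]] eps He.
  destruct (archimed_cor1 eps He) as [m [Hm Hm0]].
  destruct (INR_unbounded C) as [n Hn].
  destruct (proj2 (Hg m) f) as [j Hj].
  { exists n; split; [split; assumption |].
    apply bdd_weaken with C; [lra | exact HC]. }
  exists (to_nat (m, j)); rewrite cancel_of_to; cbn.
  apply (bdd_weaken _ (/ (INR m + 1))); [| exact Hj].
  assert (0 < INR m) by (apply lt_0_INR; exact Hm0).
  apply Rle_trans with (/ INR m); [apply Rinv_le_contravar; lra | lra].
Qed.

(* [A] is the set of functionals all of whose weak-star neighbourhoods meet the ball in a set
   that has no countable [eps]-net; removing it from the ball leaves a set that has one. *)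
Lemma perfect_set (Hsep : separable X) (Hns : ~ dual_separable (to_sn X)) :
  exists (A : (X -> scal k) -> Prop) (M eps : R), 0 < M /\ 0 < eps /\
    (exists g, A g) /\
    (forall g, A g -> lin g /\ bdd g M) /\
    forall g (L : list X) eta, A g -> 0 < eta ->
      exists g', A g' /\ (forall v, In v L -> sabs (ssub (g' v) (g v)) <= eta) /\
        ~ close g' g eps.
Proof.
destruct Hsep as [d Hd].
destruct (ball_not_covered Hns) as [M [eps [HM [He Hnc]]]].
set (B := fun f => lin f /\ bdd f M) in *.
(* As [d] is dense, these sets form a countable base of weak-star neighbourhoods of [g] within the
   ball; one index bounds both the number of points and the radius. *)
pose (U := fun N g f => forall i, (i < N)%nat -> sabs (ssub (f (d i)) (g (d i))) < / INR N).
pose (A := fun g => B g /\ forall N, (0 < N)%nat -> ~ covered eps (fun f => B f /\ U N g f)).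
assert (Hrem : covered eps (fun f => B f /\ ~ A f)).
{ apply covered_sub with (B := fun f => exists N,
    B f /\ (0 < N)%nat /\ covered eps (fun f' => B f' /\ U N f f')).
  { intros f [Bf HA]; apply NNPP; intro Hf; apply HA; split; [exact Bf |].
    intros N HN Hc; apply Hf; exists N; auto. }
  apply covered_union; intro N.
  destruct (Nat.eq_dec N 0) as [-> | HN].
  { exists (fun _ _ => szero k); split; [intros _; apply dual_zero |]; intros f [_ [F _]]; lia. }
  (* Finitely many neighbourhoods [U N g] with [g] in [B'] contain [B'], by total boundedness of the
     values at the first [N] points; each meets [B] in a covered set by the definition of [B']. *)
  set (B' := fun f => _).
  assert (HN' : 0 < INR N) by (apply lt_0_INR; lia).
  destruct (scalar_net B' (fun i f => f (d i)) N (/ INR N)) as [l [Hl1 Hl2]].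
  { apply Rinv_0_lt_compat, HN'. }
  { intros i _; exists (M * norm X (d i)); intros f [[_ Bf] _]; apply Bf. }
  apply covered_sub with (B := fun f => exists g, In g l /\ B f /\ U N g f).
  { intros f Hf; destruct (Hl2 f Hf) as [g [Hg1 Hg2]]; exists g.
    split; [exact Hg1 |]; split; [apply Hf | exact Hg2]. }
  apply (covered_list eps l (fun g f => B f /\ U N g f)).
  intros g Hg; apply (Hl1 g Hg). }
(* The part of [B] outside [A] is covered, so discarding it cannot make an uncovered set covered. *)
assert (Hdiff : forall V : (X -> scal k) -> Prop, ~ covered eps (fun f => B f /\ V f) ->
          ~ covered eps (fun f => A f /\ V f)).
{ intros V HV Hc; apply HV.
  apply covered_sub with (B := fun f => exists n : nat,
    match n with O => B f /\ ~ A f | S _ => A f /\ V f end).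
  - intros f [Bf Vf]; destruct (classic (A f)); [exists 1%nat | exists 0%nat]; auto.
  - apply covered_union; intros [| n]; assumption. }
exists A, M, eps; split; [exact HM |]; split; [exact He |]; split; [| split].
- apply NNPP; intro Hno; apply (Hdiff (fun _ => True)).
  { intro Hc; apply Hnc; revert Hc; apply covered_sub; auto. }
  exists (fun _ _ => szero k); split; [intros _; apply dual_zero |].
  intros f [Af _]; destruct Hno; eauto.
- intros g [Bg _]; exact Bg.
- intros g L eta Ag Heta.
  assert (HN : exists N, (0 < N)%nat /\ forall f, B f -> U N g f ->
            forall v, In v L -> sabs (ssub (f v) (g v)) <= eta).
  { assert (HN : exists N, forall N', (N <= N')%nat -> forall f, B f -> U N' g f ->
            forall v, In v L -> sabs (ssub (f v) (g v)) <= eta).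
    { clear - Hd HM Heta Ag; induction L as [| v L [N1 IH]].
      { exists 0%nat; intros N' _ f _ _ v []. }
      (* Both functionals change by at most [eta / 4] between [v] and [d n], which leaves [eta / 2]
         for their difference at [d n]. *)
      destruct (Hd v (eta / (4 * M))) as [n Hn]; [apply Rdiv_lt_0_compat; lra |].
      destruct (archimed_cor1 (eta / 2) ltac:(lra)) as [N2 [H2 H2']].
      exists (N1 + N2 + S n)%nat; intros N' HN' f Bf Uf u [<- | Hu]; [| apply (IH N'); auto; lia].
      assert (A1 : sabs (ssub (f (d n)) (g (d n))) < / INR N') by (apply Uf; lia).
      assert (A2 : / INR N' <= / INR N2).
      { apply Rinv_le_contravar; [apply lt_0_INR; lia | apply le_INR; lia]. }
      destruct Ag as [[Lg Bg] _], Bf as [Lf Bf].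
      assert (A3 : sabs (ssub (f v) (f (d n))) <= M * norm X (vsub v (d n)))
        by (rewrite <- lin_sub by exact Lf; apply Bf).
      assert (A4 : sabs (ssub (g v) (g (d n))) <= M * norm X (vsub v (d n)))
        by (rewrite <- lin_sub by exact Lg; apply Bg).
      assert (A5 : M * norm X (vsub v (d n)) <= eta / 4).
      { fold (vsub v (d n)) in Hn; apply Rlt_le, (Rmult_le_compat_l M) in Hn; [| lra].
        replace (M * (eta / (4 * M))) with (eta / 4) in Hn by (field; lra); exact Hn. }
      assert (T1 := ssub_triangle (f v) (f (d n)) (g v)).
      assert (T2 := ssub_triangle (f (d n)) (g (d n)) (g v)).
      rewrite (ssub_sym (g (d n))) in T2; lra. }
    destruct HN as [N HN]; exists (S N); split; [lia |]; apply (HN (S N)); lia. }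
  destruct HN as [N [HN0 HN]].
  (* If all points of [A] in [U N g] were [eps]-close to [g], the constant sequence [g] would cover
     them. *)
  apply NNPP; intro Hno; apply (Hdiff (U N g)); [apply Ag, HN0 |].
  destruct (Ag) as [[Lg Bg] _].
  exists (fun _ => g); split; [intros _; split; [exact Lg | exists M; exact Bg] |].
  intros f [Af Uf]; exists 0%nat; apply NNPP; intro Hf; apply Hno; exists f.
  split; [exact Af |]; split; [apply HN; [apply Af | exact Uf] | exact Hf].
Qed.

End Functionals.

(** * The biorthogonal system *)

(** Dependent choice in which a condition may look at the whole past. Since [P n h] sees [h] only
    below [n], the finite approximation [a n], equal to [t0] from [n] on, can stand for the final
    sequence. *)
Lemma history_choice {T : Type} (t0 : T) (P : nat -> (nat -> T) -> T -> Prop) :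
  (forall n h h' t, (forall m, (m < n)%nat -> h m = h' m) -> P n h t -> P n h' t) ->
  (forall n h, (forall m, (m < n)%nat -> P m h (h m)) -> exists t, P n h t) ->
  exists h, forall n, P n h (h n).
Proof.
intros Hext Hstep.
pose (a := fix a n := match n with
  | O => fun _ => t0
  | S n' => fun m => if Nat.eqb m n' then epsilon (inhabits t0) (P n' (a n')) else a n' m
  end).
assert (Ha : forall N m, (m < N)%nat -> a N m = a (S m) m).
{ induction N as [| N IH]; intros m Hm; [lia |].
  destruct (Nat.eq_dec m N) as [-> | E]; [reflexivity |].
  rewrite <- (IH m) by lia; cbn; apply Nat.eqb_neq in E; rewrite E; reflexivity. }
exists (fun n => a (S n) n).
intro n; induction n as [n IH] using (well_founded_induction Wf_nat.lt_wf).
apply Hext with (h := a n); [intros m Hm; apply Ha, Hm |].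
replace (a (S n) n) with (epsilon (inhabits t0) (P n (a n)))
  by (cbn; rewrite Nat.eqb_refl; reflexivity).
apply epsilon_spec, Hstep; intros m Hm.
rewrite (Ha n m Hm); apply Hext with (h := fun n => a (S n) n); [| apply IH, Hm].
intros j Hj; symmetry; apply Ha; lia.
Qed.

Section Construction.
Context {k : field_kind} {X : BanachSpace k}.
Add Ring scal_ring_k : (scal_ring k).

Fixpoint rsum (u : nat -> R) (n : nat) : R :=
  match n with O => 0 | S n' => rsum u n' + u n' end.

Lemma rsum_ge0 (u : nat -> R) n : (forall i, 0 <= u i) -> 0 <= rsum u n.
Proof. intro H; induction n as [| n IH]; cbn; [lra | specialize (H n); lra]. Qed.

Definition vcomb (a : nat -> scal k) (e : nat -> X) (n : nat) : X :=
  vsum (fun i => vscale X (a i) (e i)) n.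

Lemma vcomb_ext (a b : nat -> scal k) (e e' : nat -> X) n :
  (forall i, (i < n)%nat -> a i = b i) -> (forall i, (i < n)%nat -> e i = e' i) ->
  vcomb a e n = vcomb b e' n.
Proof.
induction n as [| n IH]; intros Ha He; [reflexivity |]; cbn; fold (vcomb a e n) (vcomb b e' n).
rewrite IH, Ha, He by auto with arith; reflexivity.
Qed.

Lemma lin_vcomb (f : X -> scal k) a e n : lin f ->
  f (vcomb a e n) = ssum (fun i => smul (a i) (f (e i))) n.
Proof.
intro H; unfold vcomb; rewrite (lin_vsum f _ _ H); apply ssum_ext; intros i _; apply (proj2 H).
Qed.

Lemma norm_vcomb (a : nat -> scal k) (e : nat -> X) n eta : 0 <= eta ->
  (forall i, (i < n)%nat -> sabs (a i) <= eta) ->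
  norm X (vcomb a e n) <= eta * rsum (fun i => norm X (e i)) n.
Proof.
intros He; induction n as [| n IH]; intro Ha; cbn; [rewrite norm0; lra |].
eapply Rle_trans; [apply norm_triangle |]; rewrite norm_scale.
assert (A := IH (fun i Hi => Ha i (Nat.lt_lt_succ_r _ _ Hi))).
assert (B := Ha n (Nat.lt_succ_diag_r n)); assert (N := norm_ge0 (e n)).
fold (vcomb a e n); nra.
Qed.

(** The parent of node [n + 1] is thus among the nodes built before it. *)
Lemma fst_of_nat_le n : (fst (of_nat n) <= n)%nat.
Proof.
destruct (of_nat n) as [a b] eqn:E; cbn.
assert (H := to_nat_non_decreasing a b).
rewrite <- E, cancel_to_of in H; lia.
Qed.

(** One stage: tree functional, perturbed difference [f n], test vector with [f n] equal to 1,
    biorthogonal vector, and the finite set on which all later [f] vanish. *)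
Record item := { itG : X -> scal k; itf : X -> scal k; itx : X; ite : X; itF : list X }.

(* Node [0] carries [g0] and node [m + 1] the functional of item [m]; node [n + 1] is a child of
   node [fst (of_nat n)], so that every node gets infinitely many children. *)
Definition prevG (g0 : X -> scal k) (h : nat -> item) (m : nat) : X -> scal k :=
  match m with O => g0 | S m' => itG (h m') end.

(* The last clause solves the moment problem [f i z = f i y], [i <= n], by a point [s] of [itF t]
   corrected along the biorthogonal vectors. *)
Definition admissible (A : (X -> scal k) -> Prop) (eps delta : R) (d : nat -> X)
    (g0 : X -> scal k) (n : nat) (h : nat -> item) (t : item) : Prop :=
  A (itG t) /\ dual (itf t) /\
  (forall j v, (j < n)%nat -> In v (itF (h j)) -> itf t v = szero k) /\
  close (itf t) (fun x => ssub (itG t x) (prevG g0 h (fst (of_nat n)) x)) (eps / 2 ^ S n) /\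
  itf t (itx t) = sone k /\ norm X (itx t) <= 2 / eps /\
  (forall j, (j < n)%nat -> itf (h j) (ite t) = szero k) /\ itf t (ite t) = sone k /\
  In (d n) (itF t) /\ In (itx t) (itF t) /\ In (ite t) (itF t) /\
  forall y, norm X y <= 1 -> exists s, In s (itF t) /\ norm X s <= 1 /\
    norm X (vadd X (vcomb (fun i => ssub (itf (h i) y) (itf (h i) s)) (fun i => ite (h i)) n)
                   (vscale X (ssub (itf t y) (itf t s)) (ite t))) <= delta.

Lemma admissible_ext A eps delta d g0 n h h' t :
  (forall m, (m < n)%nat -> h m = h' m) ->
  admissible A eps delta d g0 n h t -> admissible A eps delta d g0 n h' t.
Proof.
intros E (H1 & H2 & H3 & H4 & H5 & H6 & H7 & H8 & H9 & H10 & H11 & H12).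
repeat (split; [assumption |]).
split; [intros j v Hj; rewrite <- E by exact Hj; apply H3, Hj |].
split.
{ replace (prevG g0 h' (fst (of_nat n))) with (prevG g0 h (fst (of_nat n))); [exact H4 |].
  assert (Hp := fst_of_nat_le n); destruct (fst (of_nat n)) as [| m]; [reflexivity |].
  cbn; rewrite E by lia; reflexivity. }
repeat (split; [assumption |]).
split; [intros j Hj; rewrite <- E by exact Hj; apply H7, Hj |].
repeat (split; [assumption |]).
intros y Hy; destruct (H12 y Hy) as [s [S1 [S2 S3]]]; exists s.
split; [exact S1 |]; split; [exact S2 |].
erewrite vcomb_ext; [exact S3 | |]; intros i Hi; cbn; rewrite <- E by exact Hi; reflexivity.
Qed.

(** * One stage of the construction, and the resulting system *)

Section Step.
Context (A : (X -> scal k) -> Prop) (M eps delta : R) (d : nat -> X) (g0 : X -> scal k).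
Context (Heps : 0 < eps) (Hdelta : 0 < delta) (Ag0 : A g0).
Context (HA : forall g, A g -> lin g /\ bdd g M).
Context (Hperf : forall g (L : list X) eta, A g -> 0 < eta ->
  exists g', A g' /\ (forall v, In v L -> sabs (ssub (g' v) (g v)) <= eta) /\ ~ close g' g eps).

(** For [i < j] the vector of stage [j] was chosen in the kernel of the earlier functional; for
    [j < i] the functional vanishes on [itF (h j)], which contains the vector of stage [j]. *)
Lemma biorthogonal_history (h : nat -> item) n :
  (forall m, (m < n)%nat -> admissible A eps delta d g0 m h (h m)) ->
  forall i j, (i < n)%nat -> (j < n)%nat ->
    itf (h i) (ite (h j)) = if Nat.eqb i j then sone k else szero k.
Proof.
intros H i j Hi Hj; destruct (Nat.eqb i j) eqn:E.
- apply Nat.eqb_eq in E as <-; apply (H i Hi).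
- apply Nat.eqb_neq in E; destruct (Nat.lt_total i j) as [L | [L | L]]; [| lia |].
  + apply (H j Hj); exact L.
  + destruct (H i Hi) as (_ & _ & V & _); apply (V j); [exact L | apply (H j Hj)].
Qed.

Lemma admissible_step n h :
  (forall m, (m < n)%nat -> admissible A eps delta d g0 m h (h m)) ->
  exists t, admissible A eps delta d g0 n h t.
Proof.
intro Hh.
assert (Hbi := biorthogonal_history h n Hh).
set (g := prevG g0 h (fst (of_nat n))).
assert (Ag : A g).
{ unfold g; assert (Hp := fst_of_nat_le n); destruct (fst (of_nat n)) as [| m]; [exact Ag0 |].
  cbn; apply (Hh m); lia. }
set (L := flat_map (fun j => itF (h j)) (seq 0 n)).
assert (HL : forall j v, (j < n)%nat -> In v (itF (h j)) -> In v L).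
{ intros j v Hj Hv; apply in_flat_map; exists j; split; [apply in_seq; lia | exact Hv]. }
destruct (small_extension L) as [C [HC Hext]].
set (tau := eps / 2 ^ S n).
assert (Hpow : 1 <= 2 ^ n) by (apply pow_R1_Rle; lra).
assert (Htau : 0 < tau <= eps / 2).
{ unfold tau; cbn [pow]; split; [apply Rdiv_lt_0_compat; lra |].
  apply Rmult_le_compat_l; [lra |]; apply Rinv_le_contravar; lra. }
(* At this tolerance the correction [c] has norm at most [tau], hence at most [eps / 2]. *)
destruct (Hperf g L (tau / (C + 1)) Ag ltac:(apply Rdiv_lt_0_compat; lra))
  as [g' [Ag' [Hclose Hfar]]].
assert (Dg : dual (fun x => ssub (g' x) (g x))).
{ apply dual_minus; split; try (apply HA; assumption); exists M; apply HA; assumption. }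
destruct (Hext _ (tau / (C + 1)) Dg Hclose) as [c [Dc [Bc Ec]]].
{ apply Rlt_le, Rdiv_lt_0_compat; lra. }
assert (Bc' : bdd c tau).
{ apply bdd_weaken with (2 := Bc).
  replace tau with ((C + 1) * (tau / (C + 1))) at 2 by (field; lra).
  apply Rmult_le_compat_r; [apply Rlt_le, Rdiv_lt_0_compat; lra | lra]. }
set (f := fun x => ssub (ssub (g' x) (g x)) (c x)).
assert (Df : dual f) by (apply (dual_minus _ _ Dg Dc)).
assert (Lf : lin f) by apply Df.
(* At [x0] the difference [g' - g] exceeds [eps * norm X x0], and the correction takes away at most
   half of it. Rescaling [x0] gives a vector of norm at most [2 / eps] with value 1. *)
apply not_all_ex_not in Hfar as [x0 Hx0]; apply Rnot_le_lt in Hx0.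
assert (Hf0 : eps / 2 * norm X x0 < sabs (f x0)).
{ assert (T := sabs_le_ssub (ssub (g' x0) (g x0)) (c x0)); fold (f x0) in T.
  assert (B := Bc' x0); assert (N := norm_ge0 x0); nra. }
assert (N0 := norm_ge0 x0).
destruct (sinv_ex (f x0)) as [b Hb].
{ intro E; rewrite E, sabs0 in Hf0; nra. }
set (x := vscale X b x0).
assert (Hfx : f x = sone k) by (unfold x; rewrite (proj2 Lf); exact Hb).
assert (Nx : norm X x <= 2 / eps).
{ unfold x; rewrite norm_scale; apply (f_equal sabs) in Hb; rewrite sabs_mul, sabs1 in Hb.
  assert (P := sabs_pos b); apply Rmult_le_reg_l with (eps / 2); [lra |].
  replace (eps / 2 * (2 / eps)) with 1 by (field; lra); nra. }
set (fs := fun i => itf (h i)); set (es := fun i => ite (h i)).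
assert (Lfs : forall i, (i < n)%nat -> lin (fs i)) by (intros i Hi; apply (Hh i Hi)).
(* Removing from [x] its components along the earlier biorthogonal vectors kills the earlier
   functionals and keeps [f e = 1], because [f] vanishes on those vectors. *)
set (e := vsub x (vcomb (fun i => fs i x) es n)).
assert (Hfes : forall j, (j < n)%nat -> f (es j) = szero k).
{ intros j Hj; unfold f; rewrite Ec; [ring |]; apply (HL j); [exact Hj |]; apply (Hh j Hj). }
assert (Hfe : f e = sone k).
{ unfold e; rewrite lin_sub, lin_vcomb, Hfx by exact Lf; rewrite ssum_0; [ring |].
  intros i Hi; rewrite Hfes by exact Hi; ring. }
assert (Hfse : forall i, (i < n)%nat -> fs i e = szero k).
{ intros i Hi; unfold e; rewrite lin_sub, lin_vcomb by (apply Lfs, Hi).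
  rewrite (ssum_delta _ n i Hi).
  - unfold fs at 3, es; rewrite Hbi, Nat.eqb_refl by exact Hi; ring.
  - intros j Hj E; unfold fs at 2, es; rewrite Hbi by assumption.
    apply not_eq_sym, Nat.eqb_neq in E; rewrite E; ring. }
set (E := rsum (fun i => norm X (es i)) n + norm X e).
assert (HE : 0 <= E).
{ unfold E; apply Rplus_le_le_0_compat; [apply rsum_ge0; intro; apply norm_ge0 | apply norm_ge0]. }
(* Coefficients below [eta] along all biorthogonal vectors up to [e] give a combination of norm at
   most [eta * E <= delta]. *)
set (eta := delta / (E + 1)).
assert (Heta : 0 < eta) by (apply Rdiv_lt_0_compat; lra).
destruct (scalar_net (fun y => norm X y <= 1)
    (fun i => if Nat.eqb i n then f else fs i) (S n) eta Heta)
  as [l [Hl1 Hl2]].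
{ intros i Hi; assert (D : dual (if Nat.eqb i n then f else fs i)).
  { destruct (Nat.eqb i n) eqn:Ei; [exact Df |]; apply Nat.eqb_neq in Ei; apply (Hh i); lia. }
  destruct (dual_bound _ D) as [C' [HC' B]]; exists C'; intros y Hy.
  eapply Rle_trans; [apply B |]; nra. }
exists {| itG := g'; itf := f; itx := x; ite := e; itF := d n :: x :: e :: l |}.
unfold admissible; cbn [itG itf itx ite itF].
split; [exact Ag' |]; split; [exact Df |]; split; [| split].
{ intros j v Hj Hv; unfold f; rewrite Ec by (apply (HL j); assumption); ring. }
{ intro y; fold g tau.
  replace (ssub (f y) (ssub (g' y) (g y))) with (sopp (c y)) by (unfold f; ring).
  rewrite sabs_opp; apply Bc'. }
split; [exact Hfx |]; split; [exact Nx |]; split; [exact Hfse |]; split; [exact Hfe |].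
split; [left; reflexivity |]; split; [right; left; reflexivity |].
split; [right; right; left; reflexivity |].
intros y Hy; destruct (Hl2 y Hy) as [s [Hs1 Hs2]]; exists s.
split; [right; right; right; exact Hs1 |]; split; [apply Hl1, Hs1 |].
eapply Rle_trans; [apply norm_triangle |]; rewrite norm_scale.
assert (P1 := norm_vcomb (fun i => ssub (fs i y) (fs i s)) es n eta (Rlt_le _ _ Heta)).
lapply P1; clear P1.
2:{ intros i Hi; assert (Q := Hs2 i ltac:(lia)); cbv beta in Q.
    replace (Nat.eqb i n) with false in Q by (symmetry; apply Nat.eqb_neq; lia).
    apply Rlt_le, Q. }
intro P1; assert (P2 := Hs2 n (Nat.lt_succ_diag_r n)); cbv beta in P2; rewrite Nat.eqb_refl in P2.
assert (N := norm_ge0 e).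
assert (P3 : eta * E <= delta).
{ replace delta with (eta * (E + 1)) by (unfold eta; field; lra); nra. }
unfold E in P3; unfold fs, es in *; nra.
Qed.

Lemma biorthogonal_system :
  exists (G f : nat -> X -> scal k) (x e : nat -> X),
    (forall n, lin (G n) /\ bdd (G n) M) /\ (forall n, dual (f n)) /\
    (forall n, close (f n) (fun y => ssub (G (S n) y) (G (fst (of_nat n)) y)) (eps / 2 ^ S n)) /\
    (forall n, f n (x n) = sone k /\ norm X (x n) <= 2 / eps) /\
    (forall i j, f i (e j) = if Nat.eqb i j then sone k else szero k) /\
    (forall i j, (j < i)%nat -> f i (x j) = szero k /\ f i (d j) = szero k) /\
    forall n y, exists z, norm X z <= (1 + delta) * norm X y /\
      (forall i, (i < n)%nat -> f i z = f i y) /\ (forall i, (n <= i)%nat -> f i z = szero k).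
Proof.
destruct (history_choice {| itG := g0; itf := g0; itx := vzero X; ite := vzero X; itF := nil |}
  (admissible A eps delta d g0)) as [h Hh].
{ intros; eapply admissible_ext; eassumption. }
{ apply admissible_step. }
assert (Hbi : forall i j, itf (h i) (ite (h j)) = if Nat.eqb i j then sone k else szero k).
{ intros i j; apply (biorthogonal_history h (S (i + j))); [intros; apply Hh | lia | lia]. }
exists (prevG g0 h), (fun n => itf (h n)), (fun n => itx (h n)), (fun n => ite (h n)).
split; [intros [| n]; apply HA; [exact Ag0 | apply (Hh n)] |].
split; [intro n; apply (Hh n) |].
split; [intro n; apply (Hh n) |].
split; [intro n; split; apply (Hh n) |].
split; [exact Hbi |].
split.
{ intros i j Hij; destruct (Hh i) as (_ & _ & V & _).
  split; apply (V j _ Hij); apply (Hh j). }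
assert (Hunit : forall n y, norm X y <= 1 -> exists z, norm X z <= 1 + delta /\
  (forall i, (i < n)%nat -> itf (h i) z = itf (h i) y) /\
  (forall i, (n <= i)%nat -> itf (h i) z = szero k)).
(* With no moments to match, 0 is a solution; otherwise the last clause at stage [n] handles the
   first [n + 1] functionals. *)
{ intros [| n] y Hy.
  { exists (vzero X); rewrite norm0; split; [lra |]; split; [intros; lia |].
    intros i _; apply lin0, (Hh i). }
  assert (Hn : exists s, In s (itF (h n)) /\ norm X s <= 1 /\
    norm X (vcomb (fun i => ssub (itf (h i) y) (itf (h i) s)) (fun i => ite (h i)) (S n)) <= delta)
    by (apply (Hh n), Hy).
  destruct Hn as [s [S1 [S2 S3]]].
  (* The solution is [s] plus the combination of norm at most [delta]. Later functionals vanish on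
     [s], a point of [itF (h n)], and on the biorthogonal vectors up to stage [n]. *)
  eexists; split; [eapply Rle_trans; [apply (norm_triangle X s) |];
    apply (Rplus_le_compat _ _ _ _ S2 S3) |].
  split; intros i Hi; assert (Li : lin (itf (h i))) by apply (Hh i);
    rewrite (proj1 Li), lin_vcomb by exact Li.
  - rewrite (ssum_delta _ _ i Hi), Hbi, Nat.eqb_refl; [ring |].
    intros j _ E; rewrite Hbi; apply not_eq_sym, Nat.eqb_neq in E; rewrite E; ring.
  - rewrite ssum_0.
    + destruct (Hh i) as (_ & _ & V & _); rewrite (V n s) by (exact S1 || lia); ring.
    + intros j Hj; rewrite Hbi; replace (Nat.eqb i j) with false; [ring |].
      symmetry; apply Nat.eqb_neq; lia. }
intros n y; destruct (Req_dec (norm X y) 0) as [N0 | N0].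
{ apply norm_eq0 in N0 as ->; exists (vzero X); rewrite norm0; split; [lra |].
  split; intros i _; [reflexivity | apply lin0, (Hh i)]. }
assert (N := norm_ge0 y).
destruct (sreal_ex k (norm X y) N) as [a Ha].
destruct (sinv_ex a) as [b Hb]; [intro E; rewrite E, sabs0 in Ha; lra |].
destruct (Hunit n (vscale X b y)) as [z [Z1 [Z2 Z3]]].
{ rewrite norm_scale, <- Ha, <- sabs_mul, Hb, sabs1; lra. }
exists (vscale X a z); split; [rewrite norm_scale, Ha; nra |].
split; intros i Hi; destruct (Hh i) as (_ & [[_ Li] _] & _); rewrite Li.
- rewrite Z2, Li by exact Hi.
  transitivity (smul (smul b a) (itf (h i) y)); [ring | rewrite Hb; ring].
- rewrite Z3 by exact Hi; ring.
Qed.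

End Step.
End Construction.

(** * The quotient *)

Section Quotient.
Context {k : field_kind} {X : BanachSpace k}.
Add Ring scal_ring_k : (scal_ring k).
Context (Y : X -> Prop) (HY : closed_subspace X Y).

(** The choice in [qnorm] is meaningful because the infimum exists: it is minus the supremum of the
    negated distances. *)
Lemma qnorm_is_inf x :
  is_inf (fun d => exists y, Y y /\ d = norm X (vadd X x (vopp X y))) (qnorm X Y x).
Proof.
unfold qnorm; apply epsilon_spec.
destruct (completeness (fun r => exists y, Y y /\ r = - norm X (vsub x y))) as [m [Hm1 Hm2]].
- exists 0; intros r [y [_ ->]]; assert (N := norm_ge0 (vsub x y)); lra.
- exists (- norm X (vsub x (vzero X))), (vzero X); split; [apply HY | reflexivity].
- exists (- m); split.
  + intros z [y [Hy ->]]; fold (vsub x y).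
    assert (B := Hm1 (- norm X (vsub x y)) (ex_intro _ y (conj Hy eq_refl))); lra.
  + intros b Hb; enough (m <= - b) by lra; apply Hm2; intros r [y [Hy ->]].
    enough (b <= norm X (vsub x y)) by lra; apply Hb; exists y; auto.
Qed.

Lemma qnorm_le x y : Y y -> qnorm X Y x <= norm X (vsub x y).
Proof. intro Hy; apply (proj1 (qnorm_is_inf x)); exists y; auto. Qed.

Lemma qnorm_ge x b : (forall y, Y y -> b <= norm X (vsub x y)) -> b <= qnorm X Y x.
Proof. intro H; apply (proj2 (qnorm_is_inf x)); intros z [y [Hy ->]]; apply H, Hy. Qed.

Lemma qnorm_le_mod v w : Y (vsub v w) -> qnorm X Y v <= norm X w.
Proof.
intro H; eapply Rle_trans; [apply qnorm_le, H |]; right; f_equal.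
unfold vsub; rewrite vopp_add, vopp_opp, vaddA, vaddN, vaddC, vadd0; reflexivity.
Qed.

Lemma qnorm_le_norm x : qnorm X Y x <= norm X x.
Proof. rewrite <- (vsub0 x) at 2; apply qnorm_le, HY. Qed.

(** A functional vanishing on [Y] takes the same value at [x] and [x - y], so its bound passes to
    the infimum over [y]. *)
Lemma bdd_qnorm (f : X -> scal k) C : 0 < C -> lin f -> bdd f C ->
  (forall y, Y y -> f y = szero k) -> forall x, sabs (f x) <= C * qnorm X Y x.
Proof.
intros HC Lf Bf Zf x.
apply Rmult_le_reg_l with (/ C); [apply Rinv_0_lt_compat, HC |].
rewrite <- Rmult_assoc, Rinv_l, Rmult_1_l by lra.
apply qnorm_ge; intros y Hy.
assert (B := Bf (vsub x y)); rewrite lin_sub, (Zf y Hy) in B by exact Lf.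
replace (ssub (f x) (szero k)) with (f x) in B by ring.
apply Rmult_le_reg_l with C; [exact HC |].
rewrite <- Rmult_assoc, Rinv_r, Rmult_1_l by lra; exact B.
Qed.

Lemma partial_sum_vcomb (e : nat -> X) (a : nat -> scal k) n :
  partial_sum (quotient X Y) e a n = vcomb a e n.
Proof.
unfold partial_sum, vcomb; induction n as [| n IH]; [reflexivity |].
cbn [sn_sum vsum]; rewrite IH; reflexivity.
Qed.

End Quotient.

(** * The biorthogonal vectors as a basis of the quotient by the common kernel *)

Section Basis.
Context {k : field_kind} {X : BanachSpace k}.
Add Ring scal_ring_k : (scal_ring k).
Context (f : nat -> X -> scal k) (e d : nat -> X) (delta : R).
Context (Df : forall n, dual (f n)) (Hdelta : 0 < delta).
Context (Hbi : forall i j, f i (e j) = if Nat.eqb i j then sone k else szero k).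
Context (Hd : forall (x : X) eps, eps > 0 -> exists n, norm X (vadd X x (vopp X (d n))) < eps).
Context (Hfd : forall i j, (j < i)%nat -> f i (d j) = szero k).
Context (Hproj : forall n y, exists z, norm X z <= (1 + delta) * norm X y /\
  (forall i, (i < n)%nat -> f i z = f i y) /\ (forall i, (n <= i)%nat -> f i z = szero k)).

Definition annihilator (y : X) : Prop := forall i, f i y = szero k.

Lemma annihilator_closed : closed_subspace X annihilator.
Proof.
split; [intro i; apply lin0, Df |]; split; [| split].
- intros x y Hx Hy i; rewrite (proj1 (proj1 (Df i))), Hx, Hy; ring.
- intros a x Hx i; rewrite (proj2 (proj1 (Df i))), Hx; ring.
- intros u x Hu Hlim i.
  destruct (dual_bound _ (Df i)) as [C [HC B]].
  apply sabs_eq0, Rle_antisym; [| apply sabs_pos].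
  apply le_epsilon; intros eps He.
  destruct (Hlim (eps / C)) as [N HN]; [apply Rdiv_lt_0_compat; assumption |].
  specialize (HN N (le_n N)); fold (vsub (u N) x) in HN.
  specialize (B (vsub (u N) x)); rewrite lin_sub, (Hu N i) in B by apply Df.
  replace (ssub (szero k) (f i x)) with (sopp (f i x)) in B by ring; rewrite sabs_opp in B.
  apply (Rmult_lt_compat_l C) in HN; [| exact HC].
  replace (C * (eps / C)) with eps in HN by (field; lra); lra.
Qed.

Let Y := annihilator.
Let HY : closed_subspace X Y := annihilator_closed.

Lemma coord_vcomb a n i :
  f i (vcomb a e n) = if Nat.ltb i n then a i else szero k.
Proof.
rewrite lin_vcomb by apply Df; destruct (Nat.ltb i n) eqn:E.
- apply Nat.ltb_lt in E; rewrite (ssum_delta _ n i E).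
  + rewrite Hbi, Nat.eqb_refl; ring.
  + intros j _ Hj; rewrite Hbi; apply not_eq_sym, Nat.eqb_neq in Hj; rewrite Hj; ring.
- apply Nat.ltb_ge in E; apply ssum_0; intros j Hj; rewrite Hbi.
  replace (Nat.eqb i j) with false by (symmetry; apply Nat.eqb_neq; lia); ring.
Qed.

(** Let [w = x - d m] be small and [n > m]. As [f i (d m) = 0] for [i >= n], the error of the
    partial sum is congruent modulo [Y] to [z - w], where [z] solves the moment problem for [w]; its
    norm is at most [2 + delta] times that of [w]. *)
Lemma coord_expansion x : expansion (quotient X Y) e (fun i => f i x) x.
Proof.
intros eps He.
destruct (Hd x (eps / (2 + delta))) as [m Hm]; [apply Rdiv_lt_0_compat; lra |].
fold (vsub x (d m)) in Hm; set (w := vsub x (d m)) in *.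
exists (S m); intros n Hn; cbn; rewrite partial_sum_vcomb.
destruct (Hproj n w) as [z [Z1 [Z2 Z3]]].
apply Rle_lt_trans with (norm X (vsub z w)).
- apply (qnorm_le_mod Y HY); intro i.
  rewrite lin_sub by apply Df; change (vadd X (vcomb (fun i => f i x) e n) (vopp X x))
    with (vsub (vcomb (fun i => f i x) e n) x).
  rewrite !lin_sub, coord_vcomb by apply Df.
  destruct (Nat.ltb i n) eqn:E.
  + apply Nat.ltb_lt in E; rewrite Z2 by exact E; ring.
  + apply Nat.ltb_ge in E; rewrite Z3 by exact E.
    unfold w; rewrite lin_sub, (Hfd i m) by (apply Df || lia); ring.
- eapply Rle_lt_trans; [apply norm_triangle |]; rewrite norm_opp.
  apply (Rmult_lt_compat_l (2 + delta)) in Hm; [| lra].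
  replace ((2 + delta) * (eps / (2 + delta))) with eps in Hm by (field; lra); lra.
Qed.

(** Each [f i] is bounded for the quotient norm and equals [a i] on all partial sums beyond index
    [i]. *)
Lemma expansion_coord a x : expansion (quotient X Y) e a x -> a = fun i => f i x.
Proof.
intro Ha; apply functional_extensionality; intro i.
apply ssub_eq0, sabs_eq0, Rle_antisym; [| apply sabs_pos].
apply le_epsilon; intros eps He.
destruct (dual_bound _ (Df i)) as [C [HC B]].
destruct (Ha (eps / C)) as [N HN]; [apply Rdiv_lt_0_compat; assumption |].
specialize (HN (N + S i)%nat ltac:(lia)); rewrite partial_sum_vcomb in HN; cbn in HN.
fold (vsub (vcomb a e (N + S i)) x) in HN.
assert (Q := bdd_qnorm Y HY (f i) C HC (proj1 (Df i)) B (fun y Hy => Hy i)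
  (vsub (vcomb a e (N + S i)) x)).
rewrite lin_sub, coord_vcomb in Q by apply Df.
replace (Nat.ltb i (N + S i)) with true in Q by (symmetry; apply Nat.ltb_lt; lia).
apply (Rmult_lt_compat_l C) in HN; [| exact HC].
replace (C * (eps / C)) with eps in HN by (field; lra); lra.
Qed.

Lemma quotient_basis : schauder_basis (quotient X Y) e.
Proof.
intro x; exists (fun i => f i x); split; [apply coord_expansion |].
intros a Ha; symmetry; apply expansion_coord, Ha.
Qed.

(** For every [y] in [Y], the partial sum is congruent modulo [Y] to a solution of the moment
    problem for [x - y], of norm at most [1 + delta] times that of [x - y]; then the infimum over
    [y] is taken. *)
Lemma quotient_basis_constant : basis_constant_le (quotient X Y) e (1 + delta).
Proof.
intros x a Ha n; rewrite (expansion_coord _ _ Ha), partial_sum_vcomb; cbn.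
apply Rmult_le_reg_l with (/ (1 + delta)); [apply Rinv_0_lt_compat; lra |].
rewrite <- Rmult_assoc, Rinv_l, Rmult_1_l by lra.
apply (qnorm_ge Y HY); intros y Hy.
destruct (Hproj n (vsub x y)) as [z [Z1 [Z2 Z3]]].
apply Rmult_le_reg_l with (1 + delta); [lra |].
rewrite <- Rmult_assoc, Rinv_r, Rmult_1_l by lra.
eapply Rle_trans; [| exact Z1]; apply (qnorm_le_mod Y HY); intro i.
rewrite lin_sub, coord_vcomb by apply Df; destruct (Nat.ltb i n) eqn:E.
- apply Nat.ltb_lt in E; rewrite Z2, lin_sub, (Hy i) by (apply Df || exact E); ring.
- apply Nat.ltb_ge in E; rewrite Z3 by exact E; ring.
Qed.

(** * Non-separability of the dual of the quotient *)

Context (G : nat -> X -> scal k) (x : nat -> X) (M eps : R).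
Context (HM : 0 < M) (Heps : 0 < eps).
Context (HG : forall n, lin (G n) /\ bdd (G n) M).
Context (HfG : forall n,
  close (f n) (fun y => ssub (G (S n) y) (G (fst (of_nat n)) y)) (eps / 2 ^ S n)).
Context (Hfx : forall n, f n (x n) = sone k /\ norm X (x n) <= 2 / eps).
Context (Hfx0 : forall i j, (j < i)%nat -> f i (x j) = szero k).

Section Diagonal.
Context (h : nat -> X -> scal k).

(* A state [(c, N, s)]: [s] is a sum of [f n]'s with [n < N], and is close to [G c - G 0]. *)
Fixpoint path (m : nat) : nat * nat * (X -> scal k) :=
  match m with
  | O => (0%nat, 0%nat, fun _ => szero k)
  | S m' =>
      let '(c, N, s) := path m' in
      let n := to_nat (c, N) in
      if Rle_dec (1 / 2) (sabs (ssub (s (x n)) (h m' (x n)))) then (c, S n, s)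
      else (S n, S n, fun y => sadd (s y) (f n y))
  end.

Definition bound (m : nat) : nat := snd (fst (path m)).
Definition psum (m : nat) : X -> scal k := snd (path m).
Definition node (m : nat) : nat := to_nat (fst (path m)).

(** The two candidate values at [x (node m)] differ by 1, so they cannot both be within [1 / 2] of
    the value of [h m]. Either way the next bound lies past [node m], so this functional is never
    reconsidered. *)
Lemma path_succ m :
  (bound m <= node m)%nat /\ bound (S m) = S (node m) /\
  ((forall y, psum (S m) y = psum m y) \/
   (forall y, psum (S m) y = sadd (psum m y) (f (node m) y))) /\
  1 / 2 <= sabs (ssub (psum (S m) (x (node m))) (h m (x (node m)))).
Proof.
unfold bound, psum, node; cbn [path]; destruct (path m) as [[c N] s]; cbn [fst snd].
assert (H := to_nat_non_decreasing c N); set (n := to_nat (c, N)) in *.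
split; [lia |].
destruct (Rle_dec _ _) as [H1 | H1]; cbn [fst snd]; (split; [reflexivity |]).
- split; [left; reflexivity | exact H1].
- split; [right; reflexivity |].
  rewrite (proj1 (Hfx n)); apply Rnot_le_lt in H1.
  set (a := s (x n)) in *; set (b := h m (x n)) in *.
  assert (T := sabs_le_ssub (sone k) (sopp (ssub a b))).
  rewrite sabs1, sabs_opp in T.
  replace (ssub (sone k) (sopp (ssub a b))) with (ssub (sadd a (sone k)) b) in T by ring; lra.
Qed.

Lemma bound_ge m : (m <= bound m)%nat.
Proof.
induction m as [| m IH]; [lia |].
destruct (path_succ m) as [H1 [H2 _]]; lia.
Qed.

Lemma psum_lin m : lin (psum m) /\ forall y, Y y -> psum m y = szero k.
Proof.
induction m as [| m [L Z]]; [split; [apply lin_zero | reflexivity] |].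
destruct (path_succ m) as (_ & _ & [E | E] & _); apply functional_extensionality in E; rewrite E.
- split; assumption.
- split; [apply lin_plus; [exact L | apply Df] |].
  intros y Hy; rewrite Z, (Hy (node m)) by exact Hy; ring.
Qed.

Lemma psum_close m :
  close (psum m) (fun y => ssub (G (fst (fst (path m))) y) (G 0%nat y)) (eps - eps / 2 ^ bound m).
Proof.
induction m as [| m IH].
{ intro y; unfold psum, bound; cbn.
  replace (ssub (szero k) (ssub (G 0%nat y) (G 0%nat y))) with (szero k) by ring.
  rewrite sabs0; assert (N := norm_ge0 y); right; field. }
unfold psum, bound in *; cbn [path]; destruct (path m) as [[c N] s]; cbn [fst snd] in *.
assert (H := to_nat_non_decreasing c N); set (n := to_nat (c, N)) in *.
(* The parent of node [n + 1] is [c], so adding [f n] moves from [G c] to [G (S n)] with error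
   [eps / 2 ^ S n]; since [N <= n], the unspent [eps / 2 ^ N] pays for it and leaves
   [eps / 2 ^ S n]. *)
assert (Hp : eps / 2 ^ S n + eps / 2 ^ S n <= eps / 2 ^ N).
{ replace (eps / 2 ^ S n + eps / 2 ^ S n) with (eps / 2 ^ n).
  - apply Rmult_le_compat_l; [lra |]; apply Rinv_le_contravar; [apply pow_lt; lra |].
    apply Rle_pow; [lra | lia].
  - cbn [pow]; field; apply pow_nonzero; lra. }
assert (Hp' : 0 < eps / 2 ^ S n) by (apply Rdiv_lt_0_compat; [lra | apply pow_lt; lra]).
destruct (Rle_dec _ _) as [H1 | H1]; cbn [fst snd].
- apply bdd_weaken with (2 := IH); lra.
- intro y; assert (A := IH y); assert (B := HfG n y); cbv beta in A, B.
  replace (of_nat n) with (c, N) in B by (unfold n; rewrite cancel_of_to; reflexivity).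
  cbn [fst] in B.
  replace (ssub _ _) with (sadd (ssub (s y) (ssub (G c y) (G 0%nat y)))
    (ssub (f n y) (ssub (G (S n) y) (G c y)))) by ring.
  eapply Rle_trans; [apply sabs_add |].
  assert (Ny := norm_ge0 y); nra.
Qed.

Lemma psum_bdd m : bdd (psum m) (2 * M + eps).
Proof.
intro y; assert (A := psum_close m y); cbv beta in A.
assert (T := sabs_le_ssub (psum m y) (ssub (G (fst (fst (path m))) y) (G 0%nat y))).
assert (B := bdd_minus _ _ _ _ (proj2 (HG (fst (fst (path m))))) (proj2 (HG 0%nat)) y).
assert (P : 0 < eps / 2 ^ bound m) by (apply Rdiv_lt_0_compat; [lra | apply pow_lt; lra]).
assert (Ny := norm_ge0 y); cbv beta in B; nra.
Qed.

Lemma psum_stable v m n : (m <= n)%nat ->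
  (forall i, (bound m <= i)%nat -> f i v = szero k) -> psum n v = psum m v.
Proof.
intros Hmn Hv; enough (H : (bound m <= bound n)%nat /\ psum n v = psum m v) by apply H.
induction Hmn as [| n Hmn [B IH]]; [split; [lia | reflexivity] |].
destruct (path_succ n) as (H1 & H2 & H3 & _); split; [lia |].
destruct H3 as [E | E]; rewrite E, IH; [reflexivity |].
rewrite Hv by lia; ring.
Qed.

(** On each [d j] the sums are eventually constant; their uniform bound and the density of [d] carry
    the Cauchy property to every [y]. *)
Lemma psum_cv y : exists l, forall r, r > 0 -> exists N, forall n, (n >= N)%nat ->
  sabs (ssub (psum n y) l) < r.
Proof.
apply scal_complete; intros r Hr.
set (K := 2 * M + eps).
destruct (Hd y (r / (2 * K))) as [j Hj]; [apply Rdiv_lt_0_compat; unfold K; lra |].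
fold (vsub y (d j)) in Hj.
exists (S j); intros m n Hm Hn.
assert (Hst : forall i, (i >= S j)%nat -> psum i (d j) = psum (S j) (d j)).
{ intros i Hi; apply psum_stable; [exact Hi |].
  intros l Hl; apply Hfd; assert (B := bound_ge (S j)); lia. }
assert (A := psum_bdd m (vsub y (d j))); assert (B := psum_bdd n (vsub y (d j))).
rewrite lin_sub, Hst in A by (apply psum_lin || exact Hm).
rewrite lin_sub, Hst in B by (apply psum_lin || exact Hn).
assert (T := ssub_triangle (psum m y) (psum (S j) (d j)) (psum n y)).
rewrite (ssub_sym (psum (S j) (d j))) in T.
fold K in A, B; apply (Rmult_lt_compat_l K) in Hj; [| unfold K; lra].
replace (K * (r / (2 * K))) with (r / 2) in Hj by (field; unfold K; lra); lra.
Qed.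

End Diagonal.

Lemma quotient_dual_nonseparable : ~ dual_separable (quotient X Y).
Proof.
intros [h [_ Hh]].
destruct (choice _ (psum_cv h)) as [g Hg].
assert (Hlim : forall y a b, (forall r, r > 0 -> exists N, forall n, (n >= N)%nat ->
    sabs (ssub (psum h n y) a) <= b + r) -> sabs (ssub (g y) a) <= b).
{ intros y a b Hy; apply le_epsilon; intros r Hr.
  destruct (Hy (r / 2) ltac:(lra)) as [N1 H1], (Hg y (r / 2) ltac:(lra)) as [N2 H2].
  specialize (H1 (N1 + N2)%nat ltac:(lia)); specialize (H2 (N1 + N2)%nat ltac:(lia)).
  assert (T := ssub_triangle (g y) (psum h (N1 + N2) y) a).
  rewrite (ssub_sym (g y) (psum h (N1 + N2) y)) in T; lra. }
assert (Heq : forall y a, (forall r, r > 0 -> exists N, forall n, (n >= N)%nat ->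
    sabs (ssub (psum h n y) a) <= r) -> g y = a).
{ intros y a Hy; apply ssub_eq0, sabs_eq0, Rle_antisym; [| apply sabs_pos].
  apply Hlim; intros r Hr; rewrite Rplus_0_l; apply Hy, Hr. }
assert (Lg : lin g).
{ split.
  - intros y z; apply Heq; intros r Hr.
    destruct (Hg y (r / 2) ltac:(lra)) as [N1 H1], (Hg z (r / 2) ltac:(lra)) as [N2 H2].
    exists (N1 + N2)%nat; intros n Hn; specialize (H1 n ltac:(lia)); specialize (H2 n ltac:(lia)).
    rewrite (proj1 (proj1 (psum_lin h n))).
    replace (ssub _ _) with (sadd (ssub (psum h n y) (g y)) (ssub (psum h n z) (g z))) by ring.
    eapply Rle_trans; [apply sabs_add |]; lra.
  - intros a y; apply Heq; intros r Hr; assert (Pa := sabs_pos a).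
    destruct (Hg y (r / (sabs a + 1))) as [N HN]; [apply Rdiv_lt_0_compat; lra |].
    exists N; intros n Hn; rewrite (proj2 (proj1 (psum_lin h n))).
    replace (ssub _ _) with (smul a (ssub (psum h n y) (g y))) by ring.
    rewrite sabs_mul; specialize (HN n Hn).
    replace r with ((sabs a + 1) * (r / (sabs a + 1))) by (field; lra).
    apply Rmult_le_compat; try apply sabs_pos; lra. }
assert (Zg : forall y, Y y -> g y = szero k).
{ intros y Hy; apply Heq; intros r Hr; exists 0%nat; intros n _.
  rewrite (proj2 (psum_lin h n) y Hy), ssub_diag, sabs0; lra. }
assert (Bg : bdd g (2 * M + eps)).
{ intro y; replace (g y) with (ssub (g y) (szero k)) by ring; apply Hlim.
  intros r Hr; exists 0%nat; intros n _.
  replace (ssub (psum h n y) (szero k)) with (psum h n y) by ring.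
  assert (B := psum_bdd h n y); lra. }
(* As [norm X (x n) <= 2 / eps], this tolerance forces a gap of at most [1 / 4] at [x n], whereas
   the path keeps a gap of at least [1 / 2]. *)
destruct (Hh g) with (eps := eps / 8) as [m Hm]; [| lra |].
{ split; [apply Lg |]; split; [apply Lg |].
  exists (2 * M + eps); apply (bdd_qnorm Y HY); [lra | exact Lg | exact Bg | exact Zg]. }
destruct (path_succ h m) as (_ & Hb & _ & Hfar).
set (n := node h m) in *.
(* After stage [m] only functionals with index above [n] can be added, and these vanish at [x n]. *)
assert (Eg : g (x n) = psum h (S m) (x n)).
{ apply Heq; intros r Hr; exists (S m); intros j Hj.
  rewrite (psum_stable h (x n) (S m) j Hj), ssub_diag, sabs0; [lra |].
  intros i Hi; apply Hfx0; lia. }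
specialize (Hm (x n)); cbn in Hm; fold (ssub (g (x n)) (h m (x n))) in Hm.
rewrite Eg in Hm.
assert (Q := qnorm_le_norm Y HY (x n)); assert (Nx := proj2 (Hfx n)).
assert (Q' : eps / 8 * qnorm X Y (x n) <= eps / 8 * (2 / eps)) by (apply Rmult_le_compat_l; lra).
replace (eps / 8 * (2 / eps)) with (1 / 4) in Q' by (field; lra); lra.
Qed.

End Basis.

Theorem theorem4p2 (k : field_kind) (X : BanachSpace k) :
  separable X ->
  ~ dual_separable (to_sn X) ->
  forall delta : R, delta > 0 ->
  exists Y : X -> Prop,
    closed_subspace X Y /\
    ~ dual_separable (quotient X Y) /\
    exists e : nat -> quotient X Y,
      schauder_basis (quotient X Y) e /\
      basis_constant_le (quotient X Y) e (1 + delta).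
Proof.
intros Hsep Hns delta Hdelta.
destruct (perfect_set Hsep Hns) as (A & M & eps & HM & Heps & [g0 Ag0] & HA & Hperf).
destruct Hsep as [d Hd].
destruct (biorthogonal_system A M eps delta d g0 Heps Hdelta Ag0 HA Hperf)
  as (G & f & x & e & HG & Df & HfG & Hfx & Hbi & Hvan & Hproj).
assert (Hfx0 := fun i j Hij => proj1 (Hvan i j Hij)).
assert (Hfd := fun i j Hij => proj2 (Hvan i j Hij)).
exists (annihilator f); split; [apply annihilator_closed, Df |]; split.
- eapply quotient_dual_nonseparable with (d := d) (x := x) (M := M) (eps := eps); eassumption.
- exists e; split; [eapply quotient_basis with (d := d) (delta := delta)
                  | eapply quotient_basis_constant]; eassumption.
Qed.
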